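(* Let $\mathcal{C}$ be a braided strict monoidal category with braiding $\beta$. Then there is a unique way to extend the tensor product of $\mathcal{C}$ to its affinization $\mathrm{Aff}(\mathcal{C})$ such that $\mathrm{Aff}(\mathcal{C})$ is a strict monoidal category and $$\xi_{X,Y}\otimes 1_Z=\xi_{X\otimes Z,Y}\circ(1_X\otimes\beta_{Y,Z}),\qquad 1_X\otimes\xi_{Y,Z}=(\beta_{X,Z}^{-1}\otimes 1_Y)\circ\xi_{X\otimes Y,Z}$$ for all objects $X,Y,Z$ of $\mathcal{C}$.
   Context: All categories are essentially small; $1_X$ denotes the identity morphism of $X$. Affinization: for a strict monoidal category $\mathcal{C}$, $\mathrm{Aff}(\mathcal{C})$ is the category with the same objects as $\mathcal{C}$, obtained from $\mathcal{C}$ by adjoining (under composition) invertible morphisms $\xi_{X,Y}\colon X\otimes Y\to Y\otimes X$ for all objects $X,Y$, subject to $$\xi_{X,Y\otimes Z}=\xi_{Z\otimes X,Y}\circ\xi_{X\otimes Y,Z},\qquad \xi_{X_2,Y_2}\circ(g\otimes f)=(f\otimes g)\circ\xi_{X_1,Y_1}$$ for all objects $X,X_1,X_2,Y,Y_1,Y_2,Z$ and all $f\in\mathrm{Hom}_{\mathcal{C}}(Y_1,Y_2)$, $g\in\mathrm{Hom}_{\mathcal{C}}(X_1,X_2)$. Braiding convention: a braiding is a natural family of isomorphisms $\beta_{X,Y}\colon X\otimes Y\to Y\otimes X$ with $\beta_{X,Y\otimes Z}=(1_Y\otimes\beta_{X,Z})\circ(\beta_{X,Y}\otimes 1_Z)$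 and $\beta_{X\otimes Y,Z}=(\beta_{X,Z}\otimes 1_Y)\circ(1_X\otimes\beta_{Y,Z})$. *)

(* Defs.v *)
From HB Require Import structures.
From mathcomp Require Import all_boot.
From mathcomp Require Import generic_quotient.
From mathcomp Require Import boolp.

Set Implicit Arguments.
Unset Strict Implicit.
Unset Printing Implicit Defensive.

Local Open Scope quotient_scope.

Reserved Notation "g \oc f" (at level 50, left associativity).
Reserved Notation "X \ox Y" (at level 40, left associativity).
Reserved Notation "f \hx g" (at level 40, left associativity).

Record category := Category {
  obj :> Type;
  hom : obj -> obj -> Type;
  idm : forall A, hom A A;
  comp : forall A B D, hom B D -> hom A B -> hom A D;
  comp1m : forall A B (f : hom A B), comp (idm B) f = f;
  compm1 : forall A B (f : hom A B), comp f (idm A) = f;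
  compA : forall A B D E (h : hom D E) (g : hom B D) (f : hom A B),
    comp h (comp g f) = comp (comp h g) f
}.

Arguments hom {c} A B.
Arguments idm {c} A.
Arguments comp {c A B D} g f.
Notation "g \oc f" := (comp g f).

(* The identity of A, seen as a morphism to an object B equal to A.  Composing
   with it is the transport along an equality of objects that is left implicit
   in a strict monoidal category. *)
Definition eqm (C : category) (A B : C) (e : A = B) : hom A B :=
  match e in _ = B' return hom A B' with erefl => idm A end.

Definition homtensor (C : category) (T0 : C -> C -> C) : Type :=
  forall A A' B B' : C, hom A A' -> hom B B' -> hom (T0 A B) (T0 A' B').

(* Associativity and unitality hold as equalities of objects; the last three
   fields are the corresponding equalities of morphisms
   (f * g) * h = f * (g * h),  1 * f = f,  f * 1 = f. *)
Record is_strict_monoidal (C : category) (I : C) (T0 : C -> C -> C)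
    (T1 : homtensor T0) : Prop := IsStrictMonoidal {
  tens_idm : forall A B : C, T1 A A B B (idm A) (idm B) = idm (T0 A B);
  tens_comp : forall (A A' A'' B B' B'' : C)
      (f' : hom A' A'') (f : hom A A') (g' : hom B' B'') (g : hom B B'),
    T1 _ _ _ _ (f' \oc f) (g' \oc g) = T1 _ _ _ _ f' g' \oc T1 _ _ _ _ f g;
  tensA : forall X Y Z : C, T0 X (T0 Y Z) = T0 (T0 X Y) Z;
  tens1o : forall X : C, T0 I X = X;
  tenso1 : forall X : C, T0 X I = X;
  tensA_hom : forall (X X' Y Y' Z Z' : C)
      (f : hom X X') (g : hom Y Y') (h : hom Z Z'),
    T1 _ _ _ _ (T1 _ _ _ _ f g) h \oc eqm (tensA X Y Z)
    = eqm (tensA X' Y' Z') \oc T1 _ _ _ _ f (T1 _ _ _ _ g h);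
  tens1_hom : forall (X X' : C) (f : hom X X'),
    f \oc eqm (tens1o X) = eqm (tens1o X') \oc T1 _ _ _ _ (idm I) f;
  tens_hom1 : forall (X X' : C) (f : hom X X'),
    f \oc eqm (tenso1 X) = eqm (tenso1 X') \oc T1 _ _ _ _ f (idm I)
}.

Record smcat := SMCat {
  smcat_cat :> category;
  unito : smcat_cat;
  tenso : smcat_cat -> smcat_cat -> smcat_cat;
  tensm : homtensor tenso;
  smcatP : is_strict_monoidal unito tensm
}.

Arguments unito : clear implicits.
Arguments tensm {s A A' B B'} f g.
Notation "X \ox Y" := (tenso X Y).
Notation "f \hx g" := (tensm f g).

Section Associator.
Variables (C : smcat) (X Y Z : C).

Definition smcA : X \ox (Y \ox Z) = (X \ox Y) \ox Z := tensA (smcatP C) X Y Z.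
Definition assoc : hom (X \ox (Y \ox Z)) ((X \ox Y) \ox Z) := eqm smcA.
Definition assocV : hom ((X \ox Y) \ox Z) (X \ox (Y \ox Z)) := eqm (esym smcA).

End Associator.

Record braiding (C : smcat) := Braiding {
  braid : forall X Y : C, hom (X \ox Y) (Y \ox X);
  braidV : forall X Y : C, hom (Y \ox X) (X \ox Y);
  braidK : forall X Y : C, braidV X Y \oc braid X Y = idm (X \ox Y);
  braidVK : forall X Y : C, braid X Y \oc braidV X Y = idm (Y \ox X);
  braid_nat : forall (X X' Y Y' : C) (f : hom X X') (g : hom Y Y'),
    braid X' Y' \oc (f \hx g) = (g \hx f) \oc braid X Y;
  braid_tensr : forall X Y Z : C,
    braid X (Y \ox Z)
    = assoc Y Z X \oc (idm Y \hx braid X Z) \oc assocV Y X Z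
      \oc (braid X Y \hx idm Z) \oc assoc X Y Z;
  braid_tensl : forall X Y Z : C,
    braid (X \ox Y) Z
    = assocV Z X Y \oc (braid X Z \hx idm Y) \oc assoc X Z Y
      \oc (idm X \hx braid Y Z) \oc assocV X Y Z
}.

(* The affinization: words in the morphisms of C and the letters xi, xi^-1,
   modulo the congruence generated by the composition of C, the category
   axioms, the invertibility of xi and the two families of relations. *)
Inductive affword (C : smcat) : C -> C -> Type :=
| AffHom A B of hom A B : affword A B
| AffXi X Y : affword (X \ox Y) (Y \ox X)
| AffXiV X Y : affword (Y \ox X) (X \ox Y)
| AffComp A B D of affword B D & affword A B : affword A D.

Arguments AffHom {C A B} _.
Arguments AffXi {C} X Y.
Arguments AffXiV {C} X Y.
Arguments AffComp {C A B D} _ _.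

Inductive affrel (C : smcat) : forall A B : C, affword A B -> affword A B -> Prop :=
| affrel_refl A B (u : affword A B) : affrel u u
| affrel_sym A B (u v : affword A B) : affrel u v -> affrel v u
| affrel_trans A B (u v w : affword A B) : affrel u v -> affrel v w -> affrel u w
| affrel_cong A B D (u u' : affword B D) (v v' : affword A B) :
    affrel u u' -> affrel v v' -> affrel (AffComp u v) (AffComp u' v')
| affrel_compA A B D E (u : affword D E) (v : affword B D) (w : affword A B) :
    affrel (AffComp u (AffComp v w)) (AffComp (AffComp u v) w)
| affrel_comp1m A B (u : affword A B) : affrel (AffComp (AffHom (idm B)) u) u
| affrel_compm1 A B (u : affword A B) : affrel (AffComp u (AffHom (idm A))) u
| affrel_hom A B D (g : hom B D) (f : hom A B) :
    affrel (AffHom (g \oc f)) (AffComp (AffHom g) (AffHom f))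
| affrel_xiK X Y :
    affrel (AffComp (AffXiV X Y) (AffXi X Y)) (AffHom (idm (X \ox Y)))
| affrel_xiVK X Y :
    affrel (AffComp (AffXi X Y) (AffXiV X Y)) (AffHom (idm (Y \ox X)))
| affrel_xi_tens X Y Z :
    affrel (AffXi X (Y \ox Z))
      (AffComp (AffHom (assoc Y Z X)) (AffComp (AffXi (Z \ox X) Y)
        (AffComp (AffHom (assoc Z X Y)) (AffComp (AffXi (X \ox Y) Z)
          (AffHom (assoc X Y Z))))))
| affrel_xi_nat X1 X2 Y1 Y2 (f : hom Y1 Y2) (g : hom X1 X2) :
    affrel (AffComp (AffXi X2 Y2) (AffHom (g \hx f)))
      (AffComp (AffHom (f \hx g)) (AffXi X1 Y1)).

HB.instance Definition _ (C : smcat) (A B : C) := gen_eqMixin (affword A B).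
HB.instance Definition _ (C : smcat) (A B : C) := gen_choiceMixin (affword A B).

Section Affinization.
Variable C : smcat.

Section Hom.
Variables A B : C.

Definition affeq : rel (affword A B) := fun u v => `[< affrel u v >].

Lemma affeq_refl : reflexive affeq.
Proof. by move=> u; apply/asboolP; apply: affrel_refl. Qed.

Lemma affeq_sym : symmetric affeq.
Proof. by move=> u v; apply/asboolP/asboolP; apply: affrel_sym. Qed.

Lemma affeq_trans : transitive affeq.
Proof.
by move=> v u w /asboolP uv /asboolP vw; apply/asboolP; apply: affrel_trans vw.
Qed.

Canonical affeq_equiv := EquivRel affeq affeq_refl affeq_sym affeq_trans.

Definition affhom : Type := {eq_quot affeq}.

Definition affpi (u : affword A B) : affhom := \pi_{eq_quot affeq} u.

Definition affrepr (p : affhom) : affword A B := repr (p : {eq_quot affeq}).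

Lemma affpiP (u v : affword A B) : affpi u = affpi v <-> affrel u v.
Proof. by split=> [/eqmodP/asboolP|uv] //; apply/eqmodP/asboolP. Qed.

Lemma affreprK (p : affhom) : affpi (affrepr p) = p.
Proof. exact: reprK. Qed.

End Hom.

Definition affcomp (A B D : C) (p : affhom B D) (q : affhom A B) : affhom A D :=
  affpi (AffComp (affrepr p) (affrepr q)).

Lemma affcomp_pi (A B D : C) (u : affword B D) (v : affword A B) :
  affcomp (affpi u) (affpi v) = affpi (AffComp u v).
Proof. by apply/affpiP/affrel_cong; apply/affpiP; rewrite affreprK. Qed.

Lemma affcomp1m (A B : C) (p : affhom A B) : affcomp (affpi (AffHom (idm B))) p = p.
Proof. by rewrite -(affreprK p) affcomp_pi; apply/affpiP/affrel_comp1m. Qed.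

Lemma affcompm1 (A B : C) (p : affhom A B) : affcomp p (affpi (AffHom (idm A))) = p.
Proof. by rewrite -(affreprK p) affcomp_pi; apply/affpiP/affrel_compm1. Qed.

Lemma affcompA (A B D E : C) (p : affhom D E) (q : affhom B D) (r : affhom A B) :
  affcomp p (affcomp q r) = affcomp (affcomp p q) r.
Proof.
rewrite -(affreprK p) -(affreprK q) -(affreprK r) !affcomp_pi.
exact/affpiP/affrel_compA.
Qed.

Definition Aff : category := Category affcomp1m affcompm1 affcompA.

Definition affi (A B : C) (f : @hom C A B) : @hom Aff A B := affpi (AffHom f).

Definition xi (X Y : C) : @hom Aff (X \ox Y) (Y \ox X) := affpi (AffXi X Y).

End Affinization.

Arguments affi {C A B} f.
Arguments xi {C} X Y.

(* Tensor products on Aff C agreeing with the one of C on objects (the unit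
   object included) and on the images of the morphisms of C. *)
Definition extends_tensor (C : smcat) (T : @homtensor (Aff C) (@tenso C)) : Prop :=
  forall (A A' B B' : C) (f : @hom C A A') (g : @hom C B B'),
    T A A' B B' (affi f) (affi g) = affi (f \hx g).

(* Main.v *)
Require Import Defs.
From mathcomp Require Import all_boot.
From mathcomp Require Import boolp.

(** Why the theorem holds.  A tensor product T on the affinization is determined
    by the two families of functors - * W and W * -, since bifunctoriality
    gives T p q = (p * 1) (1 * q).  Each of these functors is prescribed on the
    morphisms of C and on the generators xi, hence everywhere: a functor out of
    the affinization, and even a natural transformation between two such
    functors, is controlled by the morphisms of C and the xi alone
    ([aff_natural], [aff_functor_eq]).  This is uniqueness ([afftens_uniq]).

    For existence, the prescribed values extend to functors [rtens] and [ltens]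
    by the universal property of the affinization ([lift]).  The relation for
    xi_{X,Y*Z} is preserved because of the hexagon axiom that splits the
    argument of the braiding on the side of Y*Z, and naturality of xi is
    preserved because the braiding is natural.  Put
    T p q = rtens p o ltens q ([afftens]).

    T is bifunctorial when rtens p and ltens q commute ([interchange]).  Fixing
    one of p, q, this says that the other family is natural, so it suffices to
    treat generators.  The only serious case is p = xi_{X,Y}, q = xi_{Z,W}
    ([interchange_xi]); both composites are there equal to
      (1_Y * beta_{X,W}^-1 * 1_Z) o xi_{X*Z,Y*W} o (1_X * beta_{Y,Z} * 1_W),
    by the hexagons, naturality of xi, and the splitting of xi_{X*Z,Y*W} and
    xi_{X*Z,W*Y}.

    Associativity of T splits into three equalities of functors,
    rtens Y o rtens X = rtens (X * Y), ltens X o ltens Y = ltens (X * Y),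
    rtens Y o ltens X = ltens X o rtens Y, and unitality into two.  On the xi,
    the first two are the hexagon axioms that split the other argument of the
    braiding, and the unit laws say that braiding with the unit object is
    trivial.

    In a strict monoidal category objects are associative only up to a
    propositional equality.  The computations are therefore made on untyped
    arrows ([arrow]): a morphism together with its ends, with a composition
    that is total and associative.  There the transports along equalities of
    objects disappear, and objects can be rewritten freely. *)

Set Implicit Arguments.
Unset Strict Implicit.
Unset Printing Implicit Defensive.

Reserved Notation "g \ao f" (at level 50, left associativity).
Reserved Notation "f \ax g" (at level 40, left associativity).

(** * Functors *)

Record functor (C D : category) := Functor {
  fobj :> C -> D;
  fhom : forall A B, hom A B -> hom (fobj A) (fobj B);
  fhom_idm : forall A, fhom (idm A) = idm (fobj A);
  fhom_comp : forall A B E (g : hom B E) (f : hom A B),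
    fhom (g \oc f) = fhom g \oc fhom f
}.

Arguments fhom {C D} F {A B} f : rename.

Definition natural (C D : category) (F G : functor C D)
    (eta : forall A, hom (F A) (G A)) : Prop :=
  forall A B (f : hom A B), eta B \oc fhom F f = fhom G f \oc eta A.

Definition idfunctor (C : category) : functor C C :=
  @Functor C C id (fun _ _ f => f) (fun _ => erefl) (fun _ _ _ _ _ => erefl).

Section Composition.
Variables (C D E : category) (G : functor D E) (F : functor C D).

Let compf A B (f : hom A B) := fhom G (fhom F f).

Lemma compf_idm A : compf (idm A) = idm (G (F A)).
Proof. by rewrite /compf !fhom_idm. Qed.

Lemma compf_comp A B A' (g : hom B A') (f : hom A B) :
  compf (g \oc f) = compf g \oc compf f.
Proof. by rewrite /compf !fhom_comp. Qed.

Definition compfunctor : functor C E := Functor compf_idm compf_comp.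

End Composition.

(** Inverting the two parallel sides of a commutative square; naturality of
    a family of isomorphisms passes in this way to their inverses. *)
Lemma inv_square (D : category) (A A' B B' : D) (a : hom A A') (aV : hom A' A)
    (c : hom B B') (cV : hom B' B) (f : hom A B) (f' : hom A' B') :
  a \oc aV = idm A' -> cV \oc c = idm B ->
  c \oc f = f' \oc a -> cV \oc f' = f \oc aV.
Proof.
move=> aK cK sq.
by rewrite -[f']compm1 -aK (Defs.compA f') -sq !Defs.compA cK comp1m.
Qed.

(** * Untyped arrows *)

Section Arrows.
Variable D : category.

(** Equality of arrows is equality of morphisms up to transport along
    equalities of objects.  [Undefined] is the absorbing result of composing
    arrows whose ends do not match; it makes composition associative without
    side conditions. *)
Inductive arrow : Type := Undefined | Arrow (A B : D) of hom A B.

Definition acomp (y x : arrow) : arrow :=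
  match y, x with
  | Arrow _ _ g, Arrow _ _ f =>
    match pselect (_ = _) with
    | left e => Arrow (g \oc eqm e \oc f)
    | right _ => Undefined
    end
  | _, _ => Undefined
  end.

Local Notation "y \ao x" := (acomp y x).

Definition aid (A : D) : arrow := Arrow (idm A).

Lemma Arrow_comp A B E (g : hom B E) (f : hom A B) :
  Arrow (g \oc f) = Arrow g \ao Arrow f.
Proof.
rewrite /=; case: pselect => // e.
by rewrite (Prop_irrelevance e erefl) /= compm1.
Qed.

Lemma acomp_defined A B E (g : hom B E) (f : hom A B) :
  Arrow g \ao Arrow f <> Undefined.
Proof. by rewrite -Arrow_comp. Qed.

Lemma acompU x : x \ao Undefined = Undefined.
Proof. by case: x. Qed.

Lemma acomp_neq A B B' E (g : hom B E) (f : hom A B') :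
  B' <> B -> Arrow g \ao Arrow f = Undefined.
Proof. by rewrite /=; case: pselect. Qed.

Lemma acompA x y z : x \ao (y \ao z) = x \ao y \ao z.
Proof.
case: x y z => [|E F h] [|B E' g] [|A B' f]; rewrite ?acompU //.
case: (pselect (B' = B)) => [eB|neB]; case: (pselect (E' = E)) => [eE|neE].
- by subst; rewrite -!Arrow_comp Defs.compA.
- by subst; rewrite -Arrow_comp !(acomp_neq _ _ neE).
- by subst; rewrite -Arrow_comp !(acomp_neq _ _ neB).
- by rewrite (acomp_neq _ _ neE) (acomp_neq _ _ neB) acompU.
Qed.

(** The laws of identities below come in two forms: for a literal [Arrow f], and
    for an arrow whose end is only provably the right object. *)
Lemma acomp1 A B (f : hom A B) : aid B \ao Arrow f = Arrow f.
Proof. by rewrite -Arrow_comp comp1m. Qed.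

Lemma acompr1 A B (f : hom A B) : Arrow f \ao aid A = Arrow f.
Proof. by rewrite -Arrow_comp compm1. Qed.

Definition has_source x A := if x is @Arrow A' _ _ then A' = A else False.
Definition has_target x B := if x is @Arrow _ B' _ then B' = B else False.

Lemma acomp1e x B : has_target x B -> aid B \ao x = x.
Proof. by case: x => //= A B' f <-; apply: acomp1. Qed.

Lemma acompr1e x A : has_source x A -> x \ao aid A = x.
Proof. by case: x => //= A' B f <-; apply: acompr1. Qed.

Lemma Arrow_eqml A B E (e : B = E) (f : hom A B) :
  Arrow (eqm e \oc f) = Arrow f.
Proof. by case: E / e; rewrite comp1m. Qed.

Lemma Arrow_eqmr A B E (e : A = B) (f : hom B E) :
  Arrow (f \oc eqm e) = Arrow f.
Proof. by case: B / e f => f; rewrite compm1. Qed.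

Lemma Arrow_fhom_eqml (C : category) (F : functor C D) A B E (e : B = E)
    (f : hom A (F B)) :
  Arrow (fhom F (eqm e) \oc f) = Arrow f.
Proof. by case: E / e; rewrite fhom_idm comp1m. Qed.

Lemma Arrow_fhom_eqmr (C : category) (F : functor C D) A B E (e : A = B)
    (f : hom (F B) E) :
  Arrow (f \oc fhom F (eqm e)) = Arrow f.
Proof. by case: B / e f => f; rewrite fhom_idm compm1. Qed.

(** No information is lost between fixed ends, as equality proofs between
    objects are unique: an identity of untyped arrows is an identity of
    morphisms. *)
Lemma Arrow_inj A B (f g : hom A B) : Arrow f = Arrow g -> f = g.
Proof.
pose same x := if x is @Arrow A' B' h then
  exists (eA : A = A') (eB : B = B'), eqm eB \oc f = h \oc eqm eA else False.
move=> efg; have: same (Arrow g).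
  by rewrite -efg; exists erefl, erefl; rewrite comp1m compm1.
case=> eA [eB]; rewrite (Prop_irrelevance eA erefl) (Prop_irrelevance eB erefl).
by rewrite comp1m compm1.
Qed.

(** This is the shape of the associativity and unit axioms of a strict monoidal
    structure, which thus become plain equalities of arrows. *)
Lemma Arrow_square A A' B B' (eA : A = A') (eB : B = B')
    (f : hom A B) (g : hom A' B') :
  Arrow f = Arrow g -> eqm eB \oc f = g \oc eqm eA.
Proof. by move=> efg; apply: Arrow_inj; rewrite Arrow_eqml Arrow_eqmr. Qed.

(** Rewriting with [x o y = z] inside a composite nested to the left. *)
Lemma acomp_tail x y z : x \ao y = z -> forall k, k \ao x \ao y = k \ao z.
Proof. by move=> <- k; rewrite acompA. Qed.

Lemma acomp_inv_uniq A B (f : hom A B) (g : hom B A) u :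
  g \oc f = idm A -> Arrow f \ao u = aid B -> aid A \ao u = u -> Arrow g = u.
Proof.
move=> gf fu <-.
by rewrite -(acompr1 g) -fu acompA -Arrow_comp gf.
Qed.

End Arrows.

Arguments Undefined {D}.
Arguments Arrow {D A B} f.
Notation "y \ao x" := (acomp y x).

Definition amap (C D : category) (F : functor C D) (x : arrow C) : arrow D :=
  if x is Arrow _ _ f then Arrow (fhom F f) else Undefined.

(** Definedness is required: F may identify objects and so make the images of
    non-composable morphisms composable. *)
Lemma amap_comp (C D : category) (F : functor C D) y x :
  y \ao x <> Undefined -> amap F (y \ao x) = amap F y \ao amap F x.
Proof.
case: y x => [|B E g] [|A B' f] //.
case: (pselect (B' = B)) => [e|neB]; last by rewrite acomp_neq.
by subst=> _; rewrite -Arrow_comp /amap fhom_comp Arrow_comp.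
Qed.

(** * The tensor product on arrows *)

Section MonoidalArrows.
Variable C : smcat.
Implicit Types (X Y Z : C) (x y z : arrow C).

Definition atens x y : arrow C :=
  match x, y with
  | Arrow _ _ f, Arrow _ _ g => Arrow (f \hx g)
  | _, _ => Undefined
  end.

Local Notation "x \ax y" := (atens x y).

Lemma atensA x y z : x \ax (y \ax z) = x \ax y \ax z.
Proof.
case: x y z => [|X X' f] [|Y Y' g] [|Z Z' h] //=.
have /(congr1 (@Arrow C _ _)) := tensA_hom (smcatP C) f g h.
by rewrite Arrow_eqml Arrow_eqmr.
Qed.

Lemma atens1x x : aid (unito C) \ax x = x.
Proof.
case: x => [|X X' f] //=.
have /(congr1 (@Arrow C _ _)) := tens1_hom (smcatP C) f.
by rewrite Arrow_eqml Arrow_eqmr.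
Qed.

Lemma atensx1 x : x \ax aid (unito C) = x.
Proof.
case: x => [|X X' f] //=.
have /(congr1 (@Arrow C _ _)) := tens_hom1 (smcatP C) f.
by rewrite Arrow_eqml Arrow_eqmr.
Qed.

Lemma aid_tens X Y : aid (X \ox Y) = aid X \ax aid Y.
Proof. by rewrite /aid /= (tens_idm (smcatP C)). Qed.

(** Definedness is required here too: the ends of two tensor products may
    coincide although those of their factors do not. *)
Lemma atens_comp x' x y' y : x' \ao x <> Undefined -> y' \ao y <> Undefined ->
  (x' \ao x) \ax (y' \ao y) = (x' \ax y') \ao (x \ax y).
Proof.
case: x' x y' y => [|A2 A3 f'] [|A1 A2' f] // [|B2 B3 g'] [|B1 B2' g] //=.
case: pselect => // eA _; case: pselect => // eB _; subst.
rewrite -[RHS]/(Arrow _ \ao Arrow _) -Arrow_comp -(tens_comp (smcatP C)).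
by rewrite /= !compm1.
Qed.

Lemma atens_idl X y' y : y' \ao y <> Undefined ->
  aid X \ax (y' \ao y) = (aid X \ax y') \ao (aid X \ax y).
Proof. by move=> y'y; rewrite -atens_comp ?acomp1. Qed.

Lemma atens_idr X y' y : y' \ao y <> Undefined ->
  (y' \ao y) \ax aid X = (y' \ax aid X) \ao (y \ax aid X).
Proof. by move=> y'y; rewrite -atens_comp ?acomp1. Qed.

Lemma atens_lr A A' B B' (f : hom A A') (g : hom B B') :
  (Arrow f \ax aid B') \ao (aid A \ax Arrow g) = Arrow f \ax Arrow g.
Proof. by rewrite -atens_comp ?acomp1 ?acompr1. Qed.

Lemma atens_rl A A' B B' (f : hom A A') (g : hom B B') :
  (aid A' \ax Arrow g) \ao (Arrow f \ax aid B) = Arrow f \ax Arrow g.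
Proof. by rewrite -atens_comp ?acomp1 ?acompr1. Qed.

Lemma oxA X Y Z : X \ox (Y \ox Z) = X \ox Y \ox Z.
Proof. exact: tensA (smcatP C) X Y Z. Qed.

Lemma ox1 X : X \ox unito C = X.
Proof. exact: tenso1 (smcatP C) X. Qed.

Lemma o1x X : unito C \ox X = X.
Proof. exact: tens1o (smcatP C) X. Qed.

End MonoidalArrows.

Notation "x \ax y" := (atens x y).

(** * The braiding on arrows *)

Section BraidingArrows.
Variables (C : smcat) (b : braiding C).
Implicit Types (X Y Z : C).

Definition br X Y : arrow C := Arrow (braid b X Y).
Definition brV X Y : arrow C := Arrow (braidV b X Y).

Lemma brK X Y : brV X Y \ao br X Y = aid (X \ox Y).
Proof. by rewrite -Arrow_comp braidK. Qed.

Lemma brVK X Y : br X Y \ao brV X Y = aid (Y \ox X).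
Proof. by rewrite -Arrow_comp braidVK. Qed.

Lemma br_nat X X' Y Y' (f : hom X X') (g : hom Y Y') :
  br X' Y' \ao (Arrow f \ax Arrow g) = (Arrow g \ax Arrow f) \ao br X Y.
Proof. by rewrite -!Arrow_comp braid_nat. Qed.

Lemma brV_nat X X' Y Y' (f : hom X X') (g : hom Y Y') :
  brV X' Y' \ao (Arrow g \ax Arrow f) = (Arrow f \ax Arrow g) \ao brV X Y.
Proof.
rewrite -!Arrow_comp; congr Arrow.
by apply: inv_square (braid_nat b f g); [exact: braidVK|exact: braidK].
Qed.

Lemma br_tensr X Y Z :
  br X (Y \ox Z) = (aid Y \ax br X Z) \ao (br X Y \ax aid Z).
Proof.
rewrite /br braid_tensr /assoc /assocV.
by rewrite Arrow_eqmr Arrow_comp Arrow_eqmr Arrow_eqml.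
Qed.

Lemma br_tensl X Y Z :
  br (X \ox Y) Z = (br X Z \ax aid Y) \ao (aid X \ax br Y Z).
Proof.
rewrite /br braid_tensl /assoc /assocV.
by rewrite Arrow_eqmr Arrow_comp Arrow_eqmr Arrow_eqml.
Qed.

Lemma brV_tensr X Y Z :
  brV X (Y \ox Z) = (brV X Y \ax aid Z) \ao (aid Y \ax brV X Z).
Proof.
apply: (acomp_inv_uniq (braidK b _ _)).
- rewrite -/(br X (Y \ox Z)) br_tensr acompA.
  have KY : (br X Y \ax aid Z) \ao (brV X Y \ax aid Z) = aid (Y \ox X \ox Z).
    by rewrite -atens_idr brVK ?aid_tens.
  rewrite (acomp_tail KY) -oxA (acompr1 (idm Y \hx braid b X Z)).
  by rewrite -[Arrow _]/(aid Y \ax br X Z) -atens_idl ?brVK // -aid_tens oxA.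
- rewrite acompA; congr (_ \ao _); rewrite oxA aid_tens.
  by rewrite -atens_idr ?acomp1.
Qed.

Lemma brV_tensl X Y Z :
  brV (X \ox Y) Z = (aid X \ax brV Y Z) \ao (brV X Z \ax aid Y).
Proof.
apply: (acomp_inv_uniq (braidK b _ _)).
- rewrite -/(br (X \ox Y) Z) br_tensl acompA.
  have KY : (aid X \ax br Y Z) \ao (aid X \ax brV Y Z) = aid (X \ox Z \ox Y).
    by rewrite -atens_idl brVK // -aid_tens oxA.
  rewrite (acomp_tail KY) (acompr1 (braid b X Z \hx idm Y)).
  by rewrite -[Arrow _]/(br X Z \ax aid Y) -atens_idr ?brVK // -aid_tens oxA.
- rewrite acompA; congr (_ \ao _); rewrite -oxA aid_tens.
  by rewrite -atens_idl ?acomp1.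
Qed.

(** By the hexagon for [I * I = I] this arrow is idempotent, and it is
    invertible. *)
Lemma br_unitr X : br X (unito C) = aid X.
Proof.
have idem := br_tensr X (unito C) (unito C).
have K := brK X (unito C).
rewrite o1x atens1x atensx1 in idem.
rewrite -[RHS](congr1 (@aid C) (ox1 X)) -K [in RHS]idem acompA K ox1.
by rewrite acomp1e //= o1x.
Qed.

Lemma brV_unitl X : brV (unito C) X = aid X.
Proof.
have idem := brV_tensl (unito C) (unito C) X.
have K := brK (unito C) X.
rewrite o1x atens1x atensx1 in idem.
rewrite -[RHS](congr1 (@aid C) (o1x X)) -K [in RHS]idem -acompA K o1x.
by rewrite acompr1e //= ox1.
Qed.

End BraidingArrows.

(** * The affinization and its universal property *)

Section Affinization.
Variable C : smcat.

Definition xiV (X Y : C) : @hom (Aff C) (Y \ox X) (X \ox Y) :=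
  affpi (AffXiV X Y).

Lemma affi_comp (A B D : C) (g : hom B D) (f : hom A B) :
  affi (g \oc f) = affi g \oc affi f.
Proof. by rewrite /= affcomp_pi; apply/affpiP/affrel_hom. Qed.

Lemma affi_eqm (A B : C) (e : A = B) : affi (eqm e) = @eqm (Aff C) A B e.
Proof. by case: B / e. Qed.

Lemma xiK (X Y : C) : xiV X Y \oc xi X Y = @idm (Aff C) (X \ox Y).
Proof. by rewrite /= affcomp_pi; apply/affpiP/affrel_xiK. Qed.

Lemma xiVK (X Y : C) : xi X Y \oc xiV X Y = @idm (Aff C) (Y \ox X).
Proof. by rewrite /= affcomp_pi; apply/affpiP/affrel_xiVK. Qed.

Lemma xi_tens (X Y Z : C) :
  xi X (Y \ox Z) = affi (assoc Y Z X) \oc (xi (Z \ox X) Y \oc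
    (affi (assoc Z X Y) \oc (xi (X \ox Y) Z \oc affi (assoc X Y Z)))).
Proof. by rewrite /affi /xi /= !affcomp_pi; apply/affpiP/affrel_xi_tens. Qed.

Lemma xi_nat (X1 X2 Y1 Y2 : C) (f : hom Y1 Y2) (g : hom X1 X2) :
  xi X2 Y2 \oc affi (g \hx f) = affi (f \hx g) \oc xi X1 Y1.
Proof. by rewrite /affi /xi /= !affcomp_pi; apply/affpiP/affrel_xi_nat. Qed.

Lemma aff_ind (P : forall A B, @hom (Aff C) A B -> Prop) :
  (forall (A B : C) (f : hom A B), P _ _ (affi f)) ->
  (forall X Y, P _ _ (xi X Y)) -> (forall X Y, P _ _ (xiV X Y)) ->
  (forall (A B D : C) (p : @hom (Aff C) B D) (q : @hom (Aff C) A B),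
     P _ _ p -> P _ _ q -> P _ _ (p \oc q)) ->
  forall A B p, P A B p.
Proof.
move=> Pi Px PxV Pc A B p; rewrite -(affreprK p).
elim: (affrepr p) => [? ? f|X Y|X Y|A' B' D u Pu v Pv] //.
- exact: Pi.
- by rewrite -affcomp_pi; apply: Pc.
Qed.

(** The morphisms along which a transformation is natural are closed under
    composition and inversion, hence it is enough that they contain the
    generators. *)
Lemma aff_natural (D : category) (F G : functor (Aff C) D)
    (eta : forall A, hom (F A) (G A)) :
  (forall (A B : C) (f : hom A B),
     eta B \oc fhom F (affi f) = fhom G (affi f) \oc eta A) ->
  (forall X Y : C, eta (Y \ox X) \oc fhom F (xi X Y)
     = fhom G (xi X Y) \oc eta (X \ox Y)) ->
  natural eta.
Proof.
move=> nat_i nat_xi A B p; elim/aff_ind: A B / p => //.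
- move=> X Y; apply: esym; apply: inv_square (esym (nat_xi X Y)).
  + by rewrite -fhom_comp xiVK fhom_idm.
  + by rewrite -fhom_comp xiK fhom_idm.
- move=> A B E p q np nq.
  by rewrite !fhom_comp Defs.compA np -!Defs.compA nq.
Qed.

(** The family of transports along [F A = G A] is natural exactly when F and G
    agree on arrows. *)
Lemma aff_functor_eq (D : category) (F G : functor (Aff C) D) :
  (forall A, F A = G A) ->
  (forall (A B : C) (f : hom A B),
     Arrow (fhom F (affi f)) = Arrow (fhom G (affi f))) ->
  (forall X Y : C, Arrow (fhom F (xi X Y)) = Arrow (fhom G (xi X Y))) ->
  forall (A B : Aff C) (p : hom A B), Arrow (fhom F p) = Arrow (fhom G p).
Proof.
move=> eFG eq_i eq_xi A B p.
rewrite -(Arrow_eqml (eFG B)) -(Arrow_eqmr (eFG A)); congr Arrow.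
apply: (@aff_natural D F G (fun A => eqm (eFG A))) => [A' B' f|X Y].
- exact: Arrow_square.
- exact: Arrow_square.
Qed.

(** The universal property: a functor on C and invertible images for the xi that
    satisfy the two families of relations define a functor on the affinization.
    The relations are stated for arrows, where no associator appears. *)
Section Lift.
Variables (D : category) (F : functor C D).
Variable G : forall X Y : C, hom (F (X \ox Y)) (F (Y \ox X)).
Variable GV : forall X Y : C, hom (F (Y \ox X)) (F (X \ox Y)).
Hypothesis GK : forall X Y, GV X Y \oc G X Y = idm (F (X \ox Y)).
Hypothesis GVK : forall X Y, G X Y \oc GV X Y = idm (F (Y \ox X)).
Hypothesis G_tens : forall X Y Z,
  Arrow (G X (Y \ox Z)) = Arrow (G (Z \ox X) Y) \ao Arrow (G (X \ox Y) Z).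
Hypothesis G_nat : forall X1 X2 Y1 Y2 (f : hom Y1 Y2) (g : hom X1 X2),
  Arrow (G X2 Y2) \ao Arrow (fhom F (g \hx f))
  = Arrow (fhom F (f \hx g)) \ao Arrow (G X1 Y1).

Fixpoint liftword (A B : C) (u : affword A B) : hom (F A) (F B) :=
  match u with
  | AffHom _ _ f => fhom F f
  | AffXi X Y => G X Y
  | AffXiV X Y => GV X Y
  | AffComp _ _ _ u v => liftword u \oc liftword v
  end.

Lemma liftword_rel (A B : C) (u v : affword A B) :
  affrel u v -> liftword u = liftword v.
Proof.
elim: A B u v / => //=.
- by move=> A B u v w _ -> _ ->.
- by move=> A B E u u' v v' _ -> _ ->.
- by move=> *; rewrite Defs.compA.
- by move=> *; rewrite fhom_idm comp1m.
- by move=> *; rewrite fhom_idm compm1.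
- by move=> *; rewrite fhom_comp.
- by move=> *; rewrite fhom_idm GK.
- by move=> *; rewrite fhom_idm GVK.
- move=> X Y Z; apply: Arrow_inj; rewrite G_tens /assoc.
  by rewrite Arrow_fhom_eqml Arrow_comp Arrow_fhom_eqml Arrow_fhom_eqmr.
- by move=> *; apply: Arrow_inj; rewrite !Arrow_comp G_nat.
Qed.

Definition lifthom (A B : Aff C) (p : hom A B) : hom (F A) (F B) :=
  liftword (affrepr p).

Lemma lifthom_pi (A B : C) (u : affword A B) : lifthom (affpi u) = liftword u.
Proof. by apply: liftword_rel; apply/affpiP; rewrite affreprK. Qed.

Lemma lifthom_idm (A : Aff C) : lifthom (idm A) = idm (F A).
Proof. by rewrite lifthom_pi /= fhom_idm. Qed.

Lemma lifthom_comp (A B E : Aff C) (p : hom B E) (q : hom A B) :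
  lifthom (p \oc q) = lifthom p \oc lifthom q.
Proof. by rewrite lifthom_pi. Qed.

Definition lift : functor (Aff C) D :=
  @Functor (Aff C) D F lifthom lifthom_idm lifthom_comp.

Lemma lift_affi (A B : C) (f : hom A B) : fhom lift (affi f) = fhom F f.
Proof. exact: lifthom_pi. Qed.

Lemma lift_xi (X Y : C) : fhom lift (xi X Y) = G X Y.
Proof. exact: lifthom_pi. Qed.

End Lift.

(** The inclusion of C on arrows.  Being the identity on objects, it respects
    composition unconditionally. *)
Definition aaff (x : arrow C) : arrow (Aff C) :=
  if x is Arrow _ _ f then Arrow (affi f) else Undefined.

Definition axi (X Y : C) : arrow (Aff C) := Arrow (xi X Y).

Lemma aaff_comp x y : aaff (x \ao y) = aaff x \ao aaff y.
Proof.
case: x y => [|B E g] [|A B' f] //.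
case: (pselect (B' = B)) => [e|neB]; last by rewrite /aaff !acomp_neq.
by subst; rewrite -Arrow_comp /aaff affi_comp Arrow_comp.
Qed.

Lemma Arrow_affi_eqml (A B D : C) (e : B = D) (p : @hom (Aff C) A B) :
  Arrow (affi (eqm e) \oc p) = Arrow p.
Proof. by rewrite affi_eqm Arrow_eqml. Qed.

Lemma Arrow_affi_eqmr (A B D : C) (e : A = B) (p : @hom (Aff C) B D) :
  Arrow (p \oc affi (eqm e)) = Arrow p.
Proof. by rewrite affi_eqm Arrow_eqmr. Qed.

Lemma axi_tens X Y Z : axi X (Y \ox Z) = axi (Z \ox X) Y \ao axi (X \ox Y) Z.
Proof.
rewrite /axi xi_tens /assoc Arrow_affi_eqml Arrow_comp Arrow_affi_eqml.
by rewrite Arrow_affi_eqmr.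
Qed.

Lemma axi_nat (X1 X2 Y1 Y2 : C) (f : hom Y1 Y2) (g : hom X1 X2) :
  axi X2 Y2 \ao aaff (Arrow g \ax Arrow f)
  = aaff (Arrow f \ax Arrow g) \ao axi X1 Y1.
Proof. by rewrite -!Arrow_comp xi_nat. Qed.

Lemma axiK X Y : Arrow (xiV X Y) \ao axi X Y = aaff (aid (X \ox Y)).
Proof. by rewrite -Arrow_comp xiK. Qed.

Lemma axiVK X Y : axi X Y \ao Arrow (xiV X Y) = aaff (aid (Y \ox X)).
Proof. by rewrite -Arrow_comp xiVK. Qed.

End Affinization.

(** * Tensoring with an object *)

Section TensorWithObject.
Variables (C : smcat) (b : braiding C).

Section Right.
Variable W : C.

Definition rtens_hom (A B : C) (f : hom A B) :
  @hom (Aff C) (A \ox W) (B \ox W) := affi (f \hx idm W).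

Lemma rtens_idm A : rtens_hom (idm A) = @idm (Aff C) (A \ox W).
Proof. by rewrite /rtens_hom (tens_idm (smcatP C)). Qed.

Lemma rtens_comp A B D (g : hom B D) (f : hom A B) :
  rtens_hom (g \oc f) = rtens_hom g \oc rtens_hom f.
Proof. by rewrite /rtens_hom -affi_comp -(tens_comp (smcatP C)) comp1m. Qed.

Definition rtensC : functor C (Aff C) :=
  @Functor C (Aff C) (fun A => A \ox W) _ rtens_idm rtens_comp.

Definition rxi (X Y : C) : @hom (Aff C) (X \ox Y \ox W) (Y \ox X \ox W) :=
  affi (assoc Y X W) \oc xi (X \ox W) Y
  \oc affi (assoc X W Y \oc (idm X \hx braid b Y W) \oc assocV X Y W).

Definition rxiV (X Y : C) : @hom (Aff C) (Y \ox X \ox W) (X \ox Y \ox W) :=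
  affi (assoc X Y W \oc (idm X \hx braidV b Y W) \oc assocV X W Y)
  \oc xiV (X \ox W) Y \oc affi (assocV Y X W).

Lemma Arrow_rxi X Y :
  Arrow (rxi X Y) = axi (X \ox W) Y \ao aaff (aid X \ax br b Y W).
Proof.
rewrite /rxi Arrow_comp Arrow_affi_eqml; congr (_ \ao _).
by rewrite -[LHS]/(aaff (Arrow _)) /assoc /assocV Arrow_eqmr Arrow_eqml.
Qed.

Lemma Arrow_rxiV X Y : Arrow (rxiV X Y)
  = aaff (aid X \ax brV b Y W) \ao Arrow (xiV (X \ox W) Y).
Proof.
rewrite /rxiV Arrow_affi_eqmr Arrow_comp; congr (_ \ao _).
by rewrite -[LHS]/(aaff (Arrow _)) /assoc /assocV Arrow_eqmr Arrow_eqml.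
Qed.

Lemma rxiK X Y : rxiV X Y \oc rxi X Y = idm (rtensC (X \ox Y)).
Proof.
apply: Arrow_inj; rewrite Arrow_comp Arrow_rxi Arrow_rxiV acompA.
rewrite (acomp_tail (axiK _ _)) -!aaff_comp -oxA.
rewrite (acompr1 (idm X \hx braidV b Y W)).
by rewrite -[Arrow _]/(aid X \ax brV b Y W) -atens_idl brK // -aid_tens oxA.
Qed.

Lemma rxiVK X Y : rxi X Y \oc rxiV X Y = idm (rtensC (Y \ox X)).
Proof.
apply: Arrow_inj; rewrite Arrow_comp Arrow_rxi Arrow_rxiV acompA.
have K : (aid X \ax br b Y W) \ao (aid X \ax brV b Y W) = aid (X \ox W \ox Y).
  by rewrite -atens_idl brVK // -aid_tens oxA.
rewrite -(acompA (axi _ _)) -aaff_comp K [_ \ao aaff _]acompr1.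
by rewrite axiVK oxA.
Qed.


(** Both sides are xi_{Z*X*W,Y} o xi_{X*W*Y,Z} o (1_X * beta_{Y*Z,W}), once the
    braiding is split by the hexagon and one half of it is moved through xi. *)
Lemma rxi_tens X Y Z :
  Arrow (rxi X (Y \ox Z)) = Arrow (rxi (Z \ox X) Y) \ao Arrow (rxi (X \ox Y) Z).
Proof.
(* Folding the hexagon back shows that the composite being split is defined. *)
rewrite !Arrow_rxi br_tensl atens_idl -?br_tensl // aaff_comp axi_tens.
have nat : axi (X \ox W \ox Y) Z \ao aaff (aid X \ax br b Y W \ax aid Z)
    = aaff (aid Z \ax aid X \ax br b Y W) \ao axi (X \ox Y \ox W) Z.
  rewrite -(atensA (aid Z)) -!oxA.
  exact: axi_nat (idm Z) (idm X \hx braid b Y W).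
rewrite !acompA atensA (acomp_tail nat) !acompA.
by rewrite !aid_tens atensA !oxA.
Qed.

(** Naturality of the braiding moves f past W, then naturality of xi applies
    to [g * 1_W] and f. *)
Lemma rxi_nat X1 X2 Y1 Y2 (f : hom Y1 Y2) (g : hom X1 X2) :
  Arrow (rxi X2 Y2) \ao aaff (Arrow g \ax Arrow f \ax aid W)
  = aaff (Arrow f \ax Arrow g \ax aid W) \ao Arrow (rxi X1 Y1).
Proof.
rewrite !Arrow_rxi.
have brf : br b Y2 W \ao (Arrow f \ax aid W)
    = (aid W \ax Arrow f) \ao br b Y1 W.
  exact: br_nat.
have e : (aid X2 \ax br b Y2 W) \ao (Arrow g \ax Arrow f \ax aid W)
    = (Arrow g \ax aid W \ax Arrow f) \ao (aid X1 \ax br b Y1 W).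
  rewrite -!atensA -!atens_comp; try exact: acomp_defined.
  by rewrite brf acomp1 acompr1.
rewrite -acompA -aaff_comp e aaff_comp !acompA; congr (_ \ao _).
rewrite -(atensA (Arrow f)); exact: axi_nat f (g \hx idm W).
Qed.

Definition rtens : functor (Aff C) (Aff C) :=
  @lift C (Aff C) rtensC rxi rxiV rxiK rxiVK rxi_tens rxi_nat.

End Right.

Section Left.
Variable W : C.

Definition ltens_hom (A B : C) (f : hom A B) :
  @hom (Aff C) (W \ox A) (W \ox B) := affi (idm W \hx f).

Lemma ltens_idm A : ltens_hom (idm A) = @idm (Aff C) (W \ox A).
Proof. by rewrite /ltens_hom (tens_idm (smcatP C)). Qed.

Lemma ltens_comp A B D (g : hom B D) (f : hom A B) :
  ltens_hom (g \oc f) = ltens_hom g \oc ltens_hom f.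
Proof. by rewrite /ltens_hom -affi_comp -(tens_comp (smcatP C)) comp1m. Qed.

Definition ltensC : functor C (Aff C) :=
  @Functor C (Aff C) (fun A => W \ox A) _ ltens_idm ltens_comp.

Definition lxi (Y Z : C) : @hom (Aff C) (W \ox (Y \ox Z)) (W \ox (Z \ox Y)) :=
  affi (assocV W Z Y \oc (braidV b W Z \hx idm Y) \oc assoc Z W Y)
  \oc xi (W \ox Y) Z \oc affi (assoc W Y Z).

Definition lxiV (Y Z : C) : @hom (Aff C) (W \ox (Z \ox Y)) (W \ox (Y \ox Z)) :=
  affi (assocV W Y Z) \oc xiV (W \ox Y) Z
  \oc affi (assocV Z W Y \oc (braid b W Z \hx idm Y) \oc assoc W Z Y).

Lemma Arrow_lxi Y Z :
  Arrow (lxi Y Z) = aaff (brV b W Z \ax aid Y) \ao axi (W \ox Y) Z.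
Proof.
rewrite /lxi Arrow_affi_eqmr Arrow_comp; congr (_ \ao _).
by rewrite -[LHS]/(aaff (Arrow _)) /assoc /assocV Arrow_eqmr Arrow_eqml.
Qed.

Lemma Arrow_lxiV Y Z : Arrow (lxiV Y Z)
  = Arrow (xiV (W \ox Y) Z) \ao aaff (br b W Z \ax aid Y).
Proof.
rewrite /lxiV Arrow_comp Arrow_affi_eqml; congr (_ \ao _).
by rewrite -[LHS]/(aaff (Arrow _)) /assoc /assocV Arrow_eqmr Arrow_eqml.
Qed.

Lemma lxiVK Y Z : lxi Y Z \oc lxiV Y Z = idm (ltensC (Z \ox Y)).
Proof.
apply: Arrow_inj; rewrite Arrow_comp Arrow_lxi Arrow_lxiV acompA.
rewrite (acomp_tail (axiVK _ _)) -!aaff_comp oxA.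
rewrite (acompr1 (braidV b W Z \hx idm Y)).
by rewrite -[Arrow _]/(brV b W Z \ax aid Y) -atens_idr brK // -aid_tens -oxA.
Qed.

Lemma lxiK Y Z : lxiV Y Z \oc lxi Y Z = idm (ltensC (Y \ox Z)).
Proof.
apply: Arrow_inj; rewrite Arrow_comp Arrow_lxi Arrow_lxiV acompA.
have K : (br b W Z \ax aid Y) \ao (brV b W Z \ax aid Y) = aid (Z \ox (W \ox Y)).
  by rewrite -atens_idr brVK // -aid_tens oxA.
rewrite -(acompA (Arrow _)) -aaff_comp K [_ \ao aaff _]acompr1.
by rewrite axiK -oxA.
Qed.

(** Both sides are (beta_{W,Y*Z}^-1 * 1_X) o xi_{Z*W*X,Y} o xi_{W*X*Y,Z}. *)
Lemma lxi_tens X Y Z :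
  Arrow (lxi X (Y \ox Z)) = Arrow (lxi (Z \ox X) Y) \ao Arrow (lxi (X \ox Y) Z).
Proof.
rewrite !Arrow_lxi brV_tensr atens_idr -?brV_tensr // aaff_comp axi_tens.
have nat : axi (W \ox (Z \ox X)) Y \ao aaff (brV b W Z \ax aid X \ax aid Y)
    = aaff (aid Y \ax brV b W Z \ax aid X) \ao axi (Z \ox (W \ox X)) Y.
  rewrite -(atensA (aid Y)) !oxA.
  exact: axi_nat (idm Y) (braidV b W Z \hx idm X).
rewrite !acompA aid_tens atensA -(acompA (aaff _)) -nat.
by rewrite !aid_tens !atensA !acompA !oxA.
Qed.

Lemma lxi_nat X1 X2 Y1 Y2 (f : hom Y1 Y2) (g : hom X1 X2) :
  Arrow (lxi X2 Y2) \ao aaff (aid W \ax (Arrow g \ax Arrow f))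
  = aaff (aid W \ax (Arrow f \ax Arrow g)) \ao Arrow (lxi X1 Y1).
Proof.
rewrite !Arrow_lxi.
have brf : brV b W Y2 \ao (Arrow f \ax aid W)
    = (aid W \ax Arrow f) \ao brV b W Y1.
  exact: brV_nat.
have e : (brV b W Y2 \ax aid X2) \ao (Arrow f \ax aid W \ax Arrow g)
    = (aid W \ax Arrow f \ax Arrow g) \ao (brV b W Y1 \ax aid X1).
  rewrite -!atens_comp; try exact: acomp_defined.
  by rewrite brf acomp1 acompr1.
have nat : axi (W \ox X2) Y2 \ao aaff (aid W \ax Arrow g \ax Arrow f)
    = aaff (Arrow f \ax aid W \ax Arrow g) \ao axi (W \ox X1) Y1.
  rewrite -(atensA (Arrow f)); exact: axi_nat f (idm W \hx g).
by rewrite !atensA (acomp_tail nat) !acompA -aaff_comp e aaff_comp.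
Qed.

Definition ltens : functor (Aff C) (Aff C) :=
  @lift C (Aff C) ltensC lxi lxiV lxiK lxiVK lxi_tens lxi_nat.

End Left.

Lemma Arrow_rtens_affi W (A B : C) (f : hom A B) :
  Arrow (fhom (rtens W) (affi f)) = aaff (Arrow f \ax aid W).
Proof. by rewrite lift_affi. Qed.

Lemma Arrow_ltens_affi W (A B : C) (f : hom A B) :
  Arrow (fhom (ltens W) (affi f)) = aaff (aid W \ax Arrow f).
Proof. by rewrite lift_affi. Qed.

Lemma rtens_xi W X Y : fhom (rtens W) (xi X Y) = rxi W X Y.
Proof. exact: lift_xi. Qed.

Lemma ltens_xi W X Y : fhom (ltens W) (xi X Y) = lxi W X Y.
Proof. exact: lift_xi. Qed.

Lemma Arrow_rtens_xi W X Y : Arrow (fhom (rtens W) (xi X Y))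
  = axi (X \ox W) Y \ao aaff (aid X \ax br b Y W).
Proof. by rewrite rtens_xi Arrow_rxi. Qed.

Lemma Arrow_ltens_xi W X Y : Arrow (fhom (ltens W) (xi X Y))
  = aaff (brV b W Y \ax aid X) \ao axi (W \ox X) Y.
Proof. by rewrite ltens_xi Arrow_lxi. Qed.

(** Both composites go from X*Y*Z*W to Y*X*W*Z and equal
    (1_Y * beta_{X,W}^-1 * 1_Z) o xi_{X*Z,Y*W} o (1_X * beta_{Y,Z} * 1_W).
    On the left the two crossings of Y and W cancel before any xi is
    moved; on the right a crossing and its inverse cancel after one of them is
    moved through xi_{X*Z,W*Y}. *)
Lemma interchange_xi X Y Z W :
  axi (X \ox (W \ox Z)) Y \ao aaff (aid X \ax br b Y (W \ox Z))
    \ao (aaff (brV b (X \ox Y) W \ax aid Z) \ao axi (X \ox Y \ox Z) W)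
  = aaff (brV b (Y \ox X) W \ax aid Z) \ao axi (Y \ox X \ox Z) W
    \ao (axi (X \ox (Z \ox W)) Y \ao aaff (aid X \ax br b Y (Z \ox W))).
Proof.
have l1 : (aid X \ax br b Y (W \ox Z)) \ao (brV b (X \ox Y) W \ax aid Z)
    = (brV b X W \ax aid Z \ax aid Y) \ao (aid W \ax aid X \ax br b Y Z).
  have K : (aid X \ax br b Y W \ax aid Z) \ao (aid X \ax brV b Y W \ax aid Z)
      = aid (X \ox (W \ox Y) \ox Z).
    rewrite -atens_idr; last exact: acomp_defined.
    by rewrite -atens_idl brVK // !aid_tens.
  rewrite br_tensr atens_idl -?br_tensr // brV_tensl atens_idr -?brV_tensl //.
  rewrite acompA !atensA (acomp_tail K).
  rewrite acompr1e; last by rewrite /= !oxA.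
  rewrite -!(atensA (brV b X W)) -!aid_tens.
  rewrite (atens_lr (braidV b X W) (braid b Y Z)).
  exact: atens_rl (braidV b X W) (braid b Y Z).
have l2 : axi (X \ox W \ox Z) Y \ao aaff (brV b X W \ax aid Z \ax aid Y)
    = aaff (aid Y \ax brV b X W \ax aid Z) \ao axi (W \ox X \ox Z) Y.
  rewrite -(atensA (aid Y)); exact: axi_nat (idm Y) (braidV b X W \hx idm Z).
have l3 : aaff (aid W \ax aid X \ax br b Y Z) \ao axi (X \ox Y \ox Z) W
    = axi (X \ox Z \ox Y) W \ao aaff (aid X \ax br b Y Z \ax aid W).
  rewrite -(atensA (aid W)) -!oxA; apply: esym.
  exact: axi_nat (idm W) (idm X \hx braid b Y Z).
have r1 : axi (X \ox Z) (W \ox Y) \ao aaff (aid X \ax aid Z \ax br b Y W)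
    = aaff (br b Y W \ax aid X \ax aid Z) \ao axi (X \ox Z) (Y \ox W).
  rewrite -!(atensA (br _ _ _)) -!aid_tens.
  exact: axi_nat (braid b Y W) (idm (X \ox Z)).
have K : (brV b Y W \ax aid X \ax aid Z) \ao (br b Y W \ax aid X \ax aid Z)
    = aid (Y \ox W \ox X \ox Z).
  by rewrite -!atens_idr ?brK //; rewrite !aid_tens.
transitivity (aaff (aid Y \ax brV b X W \ax aid Z) \ao axi (X \ox Z) (Y \ox W)
    \ao aaff (aid X \ax br b Y Z \ax aid W)).
  rewrite acompA -(acompA (axi _ _)) -aaff_comp l1 aaff_comp acompA oxA l2.
  by rewrite (acomp_tail l3) axi_tens oxA !acompA.
rewrite br_tensr atens_idl -?br_tensr // brV_tensl atens_idr -?brV_tensl //.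
have r0 : axi (Y \ox X \ox Z) W \ao axi (X \ox Z \ox W) Y
    = axi (X \ox Z) (W \ox Y).
  by rewrite axi_tens oxA.
rewrite !aaff_comp !acompA !atensA oxA (acomp_tail r0) (acomp_tail r1) acompA.
rewrite -(acompA (aaff _) (aaff _) (aaff _)) -aaff_comp K.
by rewrite -aaff_comp acompr1e ?[has_source _ _]/= ?oxA.
Qed.

Lemma interchange_left_xi D D' (f : hom D D') X Y :
  aaff (Arrow f \ax aid (Y \ox X))
    \ao (aaff (brV b D Y \ax aid X) \ao axi (D \ox X) Y)
  = aaff (brV b D' Y \ax aid X) \ao axi (D' \ox X) Y
    \ao aaff (Arrow f \ax aid (X \ox Y)).
Proof.
have nat : axi (D' \ox X) Y \ao aaff (Arrow f \ax aid X \ax aid Y)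
    = aaff (aid Y \ax Arrow f \ax aid X) \ao axi (D \ox X) Y.
  rewrite -(atensA (aid Y)); exact: axi_nat (idm Y) (f \hx idm X).
have brf : (Arrow f \ax aid Y) \ao brV b D Y
    = brV b D' Y \ao (aid Y \ax Arrow f).
  by apply: esym; apply: brV_nat.
rewrite !aid_tens !atensA (acomp_tail nat) !acompA -!aaff_comp.
by rewrite -!atens_comp ?brf //; exact: acomp_defined.
Qed.

Lemma interchange_xi_right E E' (g : hom E E') X Y :
  axi (X \ox E') Y \ao aaff (aid X \ax br b Y E')
    \ao aaff (aid (X \ox Y) \ax Arrow g)
  = aaff (aid (Y \ox X) \ax Arrow g)
    \ao (axi (X \ox E) Y \ao aaff (aid X \ax br b Y E)).
Proof.
have nat : axi (X \ox E') Y \ao aaff (aid X \ax Arrow g \ax aid Y)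
    = aaff (aid Y \ax aid X \ax Arrow g) \ao axi (X \ox E) Y.
  rewrite -(atensA (aid Y)); exact: axi_nat (idm Y) (idm X \hx g).
have brg : br b Y E' \ao (aid Y \ax Arrow g) = (Arrow g \ax aid Y) \ao br b Y E.
  exact: br_nat.
rewrite !aid_tens acompA -nat -!acompA -!aaff_comp -!atensA.
by rewrite -!atens_idl ?brg //; exact: acomp_defined.
Qed.

(** For fixed q this is naturality in p of [fun A => ltens A q], and for fixed p
    naturality in q of [fun B => rtens B p]; applying [aff_natural] in both
    variables leaves the four cases of generators. *)
Lemma interchange (A A' B B' : Aff C) (p : hom A A') (q : hom B B') :
  fhom (rtens B') p \oc fhom (ltens A) q
  = fhom (ltens A') q \oc fhom (rtens B) p.
Proof.
have nat_i (D D' : C) (f : hom D D') (E E' : Aff C) (q' : hom E E') :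
    fhom (ltens D') q' \oc fhom (rtens E) (affi f)
    = fhom (rtens E') (affi f) \oc fhom (ltens D) q'.
  apply: esym; move: E E' q'.
  apply: (@aff_natural C _ (ltens D) (ltens D')
    (fun E => fhom (rtens E) (affi f))) => [E E' g|X Y].
  - apply: Arrow_inj; rewrite !Arrow_comp !Arrow_rtens_affi !Arrow_ltens_affi.
    by rewrite -!aaff_comp (atens_lr f g) (atens_rl f g).
  - apply: Arrow_inj; rewrite !Arrow_comp !Arrow_rtens_affi !Arrow_ltens_xi.
    exact: interchange_left_xi.
apply: esym; move: A A' p.
apply: (@aff_natural C _ (rtens B) (rtens B')
  (fun A => fhom (ltens A) q)) => [A A' f|X Y]; first exact: nat_i.
apply: esym; move: B B' q.
apply: (@aff_natural C _ (ltens (X \ox Y)) (ltens (Y \ox X))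
  (fun E => fhom (rtens E) (xi X Y))) => [E E' g|Z W].
- apply: Arrow_inj; rewrite !Arrow_comp !Arrow_rtens_xi !Arrow_ltens_affi.
  exact: interchange_xi_right.
- apply: Arrow_inj; rewrite !Arrow_comp !Arrow_rtens_xi !Arrow_ltens_xi.
  exact: interchange_xi.
Qed.

End TensorWithObject.

(** * The tensor product of the affinization *)

Section TensorProduct.
Variables (C : smcat) (b : braiding C).
Local Notation rtens := (rtens b).
Local Notation ltens := (ltens b).

Definition afftens : @homtensor (Aff C) (@tenso C) :=
  fun A A' B B' p q => fhom (rtens B') p \oc fhom (ltens A) q.

Lemma amap_rtens_aaff W x : amap (rtens W) (aaff x) = aaff (x \ax aid W).
Proof. by case: x => // A B f; apply: Arrow_rtens_affi. Qed.

Lemma amap_ltens_aaff W x : amap (ltens W) (aaff x) = aaff (aid W \ax x).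
Proof. by case: x => // A B f; apply: Arrow_ltens_affi. Qed.

Lemma amap_rtens_axi W X Y : amap (rtens W) (axi X Y)
  = axi (X \ox W) Y \ao aaff (aid X \ax br b Y W).
Proof. exact: Arrow_rtens_xi. Qed.

Lemma amap_ltens_axi W X Y : amap (ltens W) (axi X Y)
  = aaff (brV b W Y \ax aid X) \ao axi (W \ox X) Y.
Proof. exact: Arrow_ltens_xi. Qed.

(** On xi_{Z,W} this is the hexagon that splits beta_{W,X*Y}. *)
Lemma rtens_rtens X Y (A B : Aff C) (p : hom A B) :
  Arrow (fhom (rtens Y) (fhom (rtens X) p)) = Arrow (fhom (rtens (X \ox Y)) p).
Proof.
apply: (@aff_functor_eq C _ (compfunctor (rtens Y) (rtens X))
  (rtens (X \ox Y))) => {A B p} [A|A B f|Z W].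
- by rewrite /= -oxA.
- rewrite -[LHS]/(amap (rtens Y) (amap (rtens X) (aaff (Arrow f)))).
  rewrite -[RHS]/(amap (rtens (X \ox Y)) (aaff (Arrow f))).
  by rewrite !amap_rtens_aaff aid_tens atensA.
- rewrite -[LHS]/(amap (rtens Y) (amap (rtens X) (axi Z W))).
  rewrite -[RHS]/(amap (rtens (X \ox Y)) (axi Z W)).
  rewrite !amap_rtens_axi amap_comp -?amap_rtens_axi //.
  rewrite !amap_rtens_axi amap_rtens_aaff br_tensr atens_idl -?br_tensr //.
  by rewrite aaff_comp !acompA aid_tens !atensA !oxA.
Qed.

(** On xi_{Z,W} this is the hexagon that splits beta_{X*Y,W}. *)
Lemma ltens_ltens X Y (A B : Aff C) (p : hom A B) :
  Arrow (fhom (ltens X) (fhom (ltens Y) p)) = Arrow (fhom (ltens (X \ox Y)) p).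
Proof.
apply: (@aff_functor_eq C _ (compfunctor (ltens X) (ltens Y))
  (ltens (X \ox Y))) => {A B p} [A|A B f|Z W].
- by rewrite /= -oxA.
- rewrite -[LHS]/(amap (ltens X) (amap (ltens Y) (aaff (Arrow f)))).
  rewrite -[RHS]/(amap (ltens (X \ox Y)) (aaff (Arrow f))).
  by rewrite !amap_ltens_aaff aid_tens atensA.
- rewrite -[LHS]/(amap (ltens X) (amap (ltens Y) (axi Z W))).
  rewrite -[RHS]/(amap (ltens (X \ox Y)) (axi Z W)).
  rewrite !amap_ltens_axi amap_comp -?amap_ltens_axi //.
  rewrite !amap_ltens_axi amap_ltens_aaff brV_tensl atens_idr -?brV_tensl //.
  by rewrite aaff_comp !acompA aid_tens !atensA !oxA.
Qed.

(** On xi_{Z,W} the two braidings act on opposite sides of the same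
    xi_{X*Z*Y,W}: the inverse crossing of X and W after it, the crossing of W
    and Y before it. *)
Lemma rtens_ltens X Y (A B : Aff C) (p : hom A B) :
  Arrow (fhom (rtens Y) (fhom (ltens X) p))
  = Arrow (fhom (ltens X) (fhom (rtens Y) p)).
Proof.
apply: (@aff_functor_eq C _ (compfunctor (rtens Y) (ltens X))
  (compfunctor (ltens X) (rtens Y))) => {A B p} [A|A B f|Z W].
- by rewrite /= -oxA.
- rewrite -[LHS]/(amap (rtens Y) (amap (ltens X) (aaff (Arrow f)))).
  rewrite -[RHS]/(amap (ltens X) (amap (rtens Y) (aaff (Arrow f)))).
  by rewrite amap_ltens_aaff !amap_rtens_aaff amap_ltens_aaff atensA.
- rewrite -[LHS]/(amap (rtens Y) (amap (ltens X) (axi Z W))).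
  rewrite -[RHS]/(amap (ltens X) (amap (rtens Y) (axi Z W))).
  rewrite amap_ltens_axi amap_rtens_axi !amap_comp
    -?amap_ltens_axi -?amap_rtens_axi //.
  rewrite amap_rtens_axi amap_ltens_axi amap_rtens_aaff amap_ltens_aaff.
  by rewrite !aid_tens !acompA !atensA !oxA.
Qed.

Lemma rtens_unit (A B : Aff C) (p : hom A B) :
  Arrow (fhom (rtens (unito C)) p) = Arrow p.
Proof.
apply: (@aff_functor_eq C _ (rtens (unito C)) (idfunctor (Aff C)))
  => {A B p} [A|A B f|X Y].
- by rewrite /= ox1.
- by rewrite Arrow_rtens_affi atensx1.
- by rewrite Arrow_rtens_xi br_unitr -aid_tens ox1 [LHS]acompr1.
Qed.

Lemma ltens_unit (A B : Aff C) (p : hom A B) :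
  Arrow (fhom (ltens (unito C)) p) = Arrow p.
Proof.
apply: (@aff_functor_eq C _ (ltens (unito C)) (idfunctor (Aff C)))
  => {A B p} [A|A B f|X Y].
- by rewrite /= o1x.
- by rewrite Arrow_ltens_affi atens1x.
- by rewrite Arrow_ltens_xi brV_unitl -aid_tens o1x [LHS]acomp1.
Qed.

Lemma afftens_idl (A B B' : Aff C) (q : hom B B') :
  afftens (idm A) q = fhom (ltens A) q.
Proof. by rewrite /afftens fhom_idm [LHS]comp1m. Qed.

Lemma afftens_idr (A A' B : Aff C) (p : hom A A') :
  afftens p (idm B) = fhom (rtens B) p.
Proof. by rewrite /afftens fhom_idm [LHS]compm1. Qed.

Lemma afftens_strict_monoidal :
  @is_strict_monoidal (Aff C) (unito C) (@tenso C) afftens.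
Proof.
unshelve econstructor.
- exact: oxA.
- exact: o1x.
- exact: ox1.
- by move=> A B; rewrite afftens_idl fhom_idm.
- move=> A A' A'' B B' B'' p' p q' q.
  rewrite /afftens !fhom_comp -[LHS]Defs.compA -[RHS]Defs.compA.
  by congr (_ \oc _); rewrite [RHS]Defs.compA -interchange -Defs.compA.
- move=> X X' Y Y' Z Z' p q r; apply: esym; apply: Arrow_square.
  rewrite /afftens !fhom_comp !Arrow_comp.
  by rewrite rtens_rtens ltens_ltens rtens_ltens acompA.
- move=> X X' p; apply: esym; apply: Arrow_square.
  by rewrite afftens_idl ltens_unit.
- move=> X X' p; apply: esym; apply: Arrow_square.
  by rewrite afftens_idr rtens_unit.
Qed.

Lemma afftens_affi : extends_tensor afftens.
Proof.
move=> A A' B B' f g; apply: Arrow_inj.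
rewrite /afftens Arrow_comp Arrow_rtens_affi Arrow_ltens_affi -aaff_comp.
by rewrite (atens_lr f g).
Qed.

(** [T - 1_Z] and [T 1_X -] are functors that agree on generators with [rtens Z]
    and [ltens X]; bifunctoriality recovers T from them. *)
Lemma afftens_uniq (T : @homtensor (Aff C) (@tenso C)) :
  (forall A B : Aff C, T _ _ _ _ (idm A) (idm B) = idm (A \ox B : Aff C)) ->
  (forall (A A' A'' B B' B'' : Aff C) (p' : hom A' A'') (p : hom A A')
      (q' : hom B' B'') (q : hom B B'),
     T _ _ _ _ (p' \oc p) (q' \oc q)
     = T _ _ _ _ p' q' \oc T _ _ _ _ p q) ->
  extends_tensor T ->
  (forall X Y Z : C,
     T (X \ox Y) (Y \ox X) Z Z (xi X Y) (@idm (Aff C) Z) = rxi b Z X Y) ->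
  (forall X Y Z : C,
     T X X (Y \ox Z) (Z \ox Y) (@idm (Aff C) X) (xi Y Z) = lxi b X Y Z) ->
  T = afftens.
Proof.
move=> idT compT extT Trxi Tlxi.
have rT Z (A A' : Aff C) (p : hom A A') :
    T _ _ _ _ p (@idm (Aff C) Z) = fhom (rtens Z) p.
  have rcomp (A1 A2 A3 : Aff C) (p2 : hom A2 A3) (p1 : hom A1 A2) :
      T _ _ _ _ (p2 \oc p1) (@idm (Aff C) Z)
      = T _ _ _ _ p2 (@idm (Aff C) Z) \oc T _ _ _ _ p1 (@idm (Aff C) Z).
    by rewrite -compT comp1m.
  pose F := @Functor (Aff C) (Aff C) (fun A => A \ox Z)
    (fun A1 A2 p => T _ _ _ _ p (@idm (Aff C) Z)) (fun A => idT A Z) rcomp.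
  apply: Arrow_inj.
  apply: (@aff_functor_eq C _ F (rtens Z)) => // [A1 A2 f|X Y].
  - rewrite Arrow_rtens_affi [RHS]/=; congr Arrow; exact: extT.
  - rewrite rtens_xi; congr Arrow; exact: Trxi.
have lT X (A A' : Aff C) (p : hom A A') :
    T _ _ _ _ (@idm (Aff C) X) p = fhom (ltens X) p.
  have lcomp (A1 A2 A3 : Aff C) (p2 : hom A2 A3) (p1 : hom A1 A2) :
      T _ _ _ _ (@idm (Aff C) X) (p2 \oc p1)
      = T _ _ _ _ (@idm (Aff C) X) p2 \oc T _ _ _ _ (@idm (Aff C) X) p1.
    by rewrite -compT comp1m.
  pose F := @Functor (Aff C) (Aff C) (fun A => X \ox A)
    (fun A1 A2 p => T _ _ _ _ (@idm (Aff C) X) p) (fun A => idT X A) lcomp.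
  apply: Arrow_inj.
  apply: (@aff_functor_eq C _ F (ltens X)) => // [A1 A2 f|Y Z].
  - rewrite Arrow_ltens_affi [RHS]/=; congr Arrow; exact: extT.
  - rewrite ltens_xi; congr Arrow; exact: Tlxi.
do 6![apply: functional_extensionality_dep => ?].
by rewrite /afftens -rT -lT -compT comp1m compm1.
Qed.

End TensorProduct.

Theorem proposition2p5 (C : smcat) (b : braiding C) :
  exists! T : @homtensor (Aff C) (@tenso C),
    [/\ @is_strict_monoidal (Aff C) (unito C) (@tenso C) T,
        extends_tensor T,
        (forall X Y Z : C,
           T (X \ox Y) (Y \ox X) Z Z (xi X Y) (@idm (Aff C) Z)
           = affi (assoc Y X Z) \oc xi (X \ox Z) Y
             \oc affi (assoc X Z Y \oc (idm X \hx braid b Y Z) \oc assocV X Y Z))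
      & (forall X Y Z : C,
           T X X (Y \ox Z) (Z \ox Y) (@idm (Aff C) X) (xi Y Z)
           = affi (assocV X Z Y \oc (braidV b X Z \hx idm Y) \oc assoc Z X Y)
             \oc xi (X \ox Y) Z \oc affi (assoc X Y Z))].
Proof.
exists (afftens b); split=> [|T [smT extT Trxi Tlxi]]; last first.
  apply: esym; apply: afftens_uniq => //; last exact: tens_comp smT.
  exact: tens_idm smT.
split.
- exact: afftens_strict_monoidal.
- exact: afftens_affi.
- by move=> X Y Z; rewrite afftens_idr rtens_xi.
- by move=> X Y Z; rewrite afftens_idl ltens_xi.
Qed.
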